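(* Let $F\to M$ be a Lie algebroid over a smooth manifold $M$. The following two statements hold. (1) Let $E\to M$ be a Lie algebroid, let $K\colon E\to F$ be a morphism of Lie algebroids, and suppose $(\nabla,\zeta)$ is a strict $K$-adjustment on $E$. Then $$H(\mu,\nu):=t_{\nabla^{\mathrm{bas}}}(\mu,\nu)+\zeta\bigl(K(\mu),K(\nu)\bigr)\qquad(\mu,\nu\in\Gamma(E))$$ is a field of Lie brackets on the vector bundle $E$, i.e. it defines a BLA structure $E_H$ on $E$; and $(\nabla^\zeta,\zeta)$ is a strict YM $F$-connection on $E_H$. Furthermore, the Lie algebroid $E$ is the $K$-twisted action algebroid induced by $H$ and $(\nabla^\zeta,\zeta)$, that is, $\rho_E=\rho_F\circ K$ and $$[\mu,\nu]_E=H(\mu,\nu)+\nabla^\zeta_{K(\mu)}\nu-\nabla^\zeta_{K(\nu)}\mu+\zeta\bigl(K(\mu),K(\nu)\bigr)\qquad\text{for all }\mu,\nu\in\Gamma(E).$$ (2) Conversely, let $E_H\to M$ be a BLA with field of Lie brackets $H$, let $(\nabla^\zeta,\zeta)$ be a strict YM $F$-connection on $E_H$, let $K\colon E_H\to F$ be a vector bundle morphism such that $$[K(\mu),K(\nu)]_F=K\Bigl(H(\mu,\nu)+\nabla^\zeta_{K(\mu)}\nu-\nabla^\zeta_{K(\nu)}\mu+\zeta\bigl(K(\mu),K(\nu)\bigr)\Bigr)\qquad\text{for all }\mu,\nu\in\Gamma(E_H),$$ and let $E$ be the induced $K$-twisted action algebroid. Define an $F$-connection $\nabla$ on $E$ by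 $\nabla_X\mu:=\nabla^\zeta_X\mu+\zeta\bigl(X,K(\mu)\bigr)$ for all $X\in\Gamma(F)$, $\mu\in\Gamma(E)$. Then $(\nabla,\zeta)$ is a strict $K$-adjustment on $E$, and $H(\mu,\nu)=t_{\nabla^{\mathrm{bas}}}(\mu,\nu)+\zeta\bigl(K(\mu),K(\nu)\bigr)$ for all $\mu,\nu\in\Gamma(E)$, where $\nabla^{\mathrm{bas}}$ is the basic $K$-connection of $\nabla$.
   Context: Everything is smooth. For a Lie algebroid $A\to M$, $\rho_A$ is its anchor and $[\cdot,\cdot]_A$ its bracket. Morphisms of Lie algebroids over $M$ cover the identity. A BLA (bundle of Lie algebras) is a vector bundle $E\to M$ with a smooth tensor field of Lie brackets on its fibres (field of Lie brackets); it is viewed as a Lie algebroid with zero anchor. For a Lie algebroid $F$ and a vector bundle $E$ over $M$, an $F$-connection on $E$ is an $\mathbb R$-bilinear map $\nabla\colon\Gamma(F)\times\Gamma(E)\to\Gamma(E)$, $C^\infty(M)$-linear in the first argument, with $\nabla_X(f\mu)=f\nabla_X\mu+(\rho_F(X)f)\mu$. Its curvature is $R_\nabla(X,Y)\mu=\nabla_X\nabla_Y\mu-\nabla_Y\nabla_X\mu-\nabla_{[X,Y]_F}\mu$. Put $\Omega^k(F;E)=\Gamma(\bigwedge^kF^*\otimes E)$; for $\zeta\in\Omega^2(F;E)$, $(\mathrm d^\nabla\zeta)(X,Y,Z)=\sum_{\mathrm{cyc}(X,Y,Z)}\bigl(\nabla_X(\zeta(Y,Z))-\zeta([X,Y]_F,Z)\bigr)$.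 YM $F$-connection: if $E$ is a BLA with field of Lie brackets $H$, a pair $(\nabla,\zeta)$ of an $F$-connection $\nabla$ on $E$ and $\zeta\in\Omega^2(F;E)$ is a YM $F$-connection if $\nabla H=0$ (i.e. $\nabla_X(H(\mu,\nu))=H(\nabla_X\mu,\nu)+H(\mu,\nabla_X\nu)$) and $R_\nabla(X,Y)\nu=H(\zeta(X,Y),\nu)$. It is strict if also $\mathrm d^\nabla\zeta=0$. Now let $E,F\to M$ be Lie algebroids, $K\colon E\to F$ a morphism of Lie algebroids and $\nabla$ an $F$-connection on $E$. The basic $K$-connection $\nabla^{\mathrm{bas}}$ of $\nabla$ is the pair of $E$-connections, on $E$ and on $F$, given by $\nabla^{\mathrm{bas}}_\mu\nu=[\mu,\nu]_E+\nabla_{K(\nu)}\mu$ and $\nabla^{\mathrm{bas}}_\mu X=[K(\mu),X]_F+K(\nabla_X\mu)$. Its torsion (on $E$) is $t_{\nabla^{\mathrm{bas}}}(\mu,\nu)=\nabla^{\mathrm{bas}}_\mu\nu-\nabla^{\mathrm{bas}}_\nu\mu-[\mu,\nu]_E$. $\nabla$ is a Cartan $K$-connection if for all $\mu,\nu\in\Gamma(E)$, $X\in\Gamma(F)$: $\nabla_X([\mu,\nu]_E)-[\nabla_X\mu,\nu]_E-[\mu,\nabla_X\nu]_E-\nabla_{\nabla^{\mathrm{bas}}_\nu X}\mu+\nabla_{\nabla^{\mathrm{bas}}_\mu X}\nu=0$. For $\zeta\in\Omega^2(F;E)$ put $\nabla^\zeta_X\nu=\nabla_X\nu-\zeta(X,K(\nu))$.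 A $K$-adjustment is a pair $(\nabla,\zeta)$ with $\nabla$ a Cartan $K$-connection and $\zeta\in\Omega^2(F;E)$ such that $R_\nabla=-\mathrm d^{\nabla^{\mathrm{bas}}}\zeta$, i.e. $R_\nabla(X,Y)\nu=-\nabla^{\mathrm{bas}}_\nu(\zeta(X,Y))+\zeta(\nabla^{\mathrm{bas}}_\nu X,Y)+\zeta(X,\nabla^{\mathrm{bas}}_\nu Y)$ for all $X,Y\in\Gamma(F)$, $\nu\in\Gamma(E)$. It is strict if $\mathrm d^{\nabla^\zeta}\zeta=0$. $K$-twisted action algebroid: given a BLA $E_H$, a strict YM $F$-connection $(\nabla^\zeta,\zeta)$ on $E_H$ and a vector bundle morphism $K\colon E_H\to F$ satisfying the displayed condition in (2), the induced $K$-twisted action algebroid $E$ is the vector bundle $E_H$ with anchor $\rho_F\circ K$ and bracket $[\mu,\nu]_E=H(\mu,\nu)+\nabla^\zeta_{K(\mu)}\nu-\nabla^\zeta_{K(\nu)}\mu+\zeta(K(\mu),K(\nu))$; it is a Lie algebroid and $K\colon E\to F$ is a morphism of Lie algebroids. (In (2) the symbol $\nabla^\zeta$ denotes the given connection; it agrees with the notation above for the $\nabla$ defined there.) *)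

(* Defs.v *)
From HB Require Import structures.
From mathcomp Require Import all_boot all_order all_algebra.
From mathcomp Require Import all_classical all_reals all_analysis.

Set Implicit Arguments.
Unset Strict Implicit.
Unset Printing Implicit Defensive.

Import Order.TTheory GRing.Theory Num.Theory.
Import numFieldNormedType.Exports.

Local Open Scope classical_set_scope.
Local Open Scope ring_scope.

Lemma near_eq_differentiable (R : realType) (V W : normedModType R)
    (f g : V -> W) (p : V) :
  (\forall q \near p, f q = g q) -> differentiable f p -> differentiable g p.
Proof.
move=> fg /diff_locallyP[cdf fE].
have gE : g \o shift p = cst (g p) + 'd f p +o_ 0 id.
  apply/eqaddoP => e e0; have /eqaddoP/(_ e e0) := fE.
  apply: filter_app.
  have : \forall h \near (0 : V), f (h + p) = g (h + p).
    by have := fg; rewrite (near_shift 0 p) subr0.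
  apply: filterS => h fgh.
  by rewrite /= !fctE /= (nbhs_singleton fg) fgh.
by apply/diff_locallyP; rewrite (diff_unique cdf gE).
Qed.

Section Euclidean.
Variables (R : realType) (n : nat).
Implicit Types (W : set 'rV[R]_n) (f g : 'rV[R]_n -> R).

(* Meaningful for open [W] only: the values of [f] outside [W] are junk. *)
Fixpoint Ck (k : nat) W f : Prop :=
  match k with
  | 0 => forall p, W p -> {for p, continuous f}
  | k'.+1 => (forall p, W p -> differentiable f p) /\
             (forall v, Ck k' W ('D_v f))
  end.

Definition Cinfty W f := forall k, Ck k W f.

Lemma Ck_pointwise k W f : Ck k W f <-> (forall p, W p -> Ck k [set p] f).
Proof.
elim: k f => [|k IH] f /=.
  by split=> [h p Wp _ ->|h p Wp]; [exact: h|exact: (h p)].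
split=> [[h1 h2] p Wp|h].
  by split=> [_ ->|v]; [exact: h1|have /IH := h2 v; exact].
split=> [p Wp|v]; first by have [+ _] := h p Wp; exact.
by apply/IH => p Wp; have [_] := h p Wp; exact.
Qed.

Lemma Ck_sub k W W' f : W `<=` W' -> Ck k W' f -> Ck k W f.
Proof. by move=> sWW' /Ck_pointwise h; apply/Ck_pointwise => p /sWW'; exact: h. Qed.

Lemma Ck_near k W f g : (forall p, W p -> \forall q \near p, f q = g q) ->
  Ck k W f -> Ck k W g.
Proof.
elim: k f g => [|k IH] f g fg /=.
  move=> h p Wp; have := h p Wp.
  rewrite /prop_for /continuous_at -(nbhs_singleton (fg p Wp)).
  by apply: cvg_trans; exact: (@near_eq_cvg _ _ _ (nbhs_filter p) _ _ (fg p Wp)).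
move=> [h1 h2]; split=> [p Wp|v].
  exact: near_eq_differentiable (fg p Wp) (h1 p Wp).
apply: IH (h2 v) => p Wp; have := near_join (fg p Wp).
by apply: filterS => q; exact: near_eq_derive.
Qed.

Lemma Ck_pred k W f : Ck k.+1 W f -> Ck k W f.
Proof.
elim: k f => [|k IH] f [h1 h2].
  by move=> p Wp; apply: differentiable_continuous; exact: h1.
by split=> // v; exact/IH/h2.
Qed.

Lemma Ck_cst k W a : Ck k W (cst a).
Proof.
elim: k a => [|k IH] a /=; first by move=> p _; exact: cst_continuous.
split=> [p _|v]; first exact: differentiable_cst.
suff -> : 'D_v (cst a : 'rV[R]_n -> R) = cst 0 by exact: IH.
by apply/funext => p; rewrite derive_cst.
Qed.

Lemma CkD k W f g : open W -> Ck k W f -> Ck k W g -> Ck k W (f + g).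
Proof.
move=> oW; elim: k f g => [|k IH] f g /=.
  by move=> hf hg p Wp; apply: continuousD; [exact: hf|exact: hg].
move=> [hf1 hf2] [hg1 hg2]; split=> [p Wp|v].
  by apply: differentiableD; [exact: hf1|exact: hg1].
apply: Ck_near (IH _ _ (hf2 v) (hg2 v)) => p Wp.
have : \forall q \near p, W q by exact: open_nbhs_nbhs.
apply: filterS => q Wq; rewrite deriveD//; apply: diff_derivable.
  exact: hf1.
exact: hg1.
Qed.

Lemma CkM k W f g : open W -> Ck k W f -> Ck k W g -> Ck k W (f * g).
Proof.
move=> oW; elim: k f g => [|k IH] f g /=.
  by move=> hf hg p Wp; apply: continuousM; [exact: hf|exact: hg].
move=> hf hg; have kf := Ck_pred hf; have kg := Ck_pred hg.
move: hf hg => [hf1 hf2] [hg1 hg2]; split=> [p Wp|v].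
  by apply: differentiableM; [exact: hf1|exact: hg1].
apply: Ck_near (CkD oW (IH _ _ kf (hg2 v)) (IH _ _ kg (hf2 v))) => p Wp.
have : \forall q \near p, W q by exact: open_nbhs_nbhs.
apply: filterS => q Wq; rewrite deriveM//; apply: diff_derivable.
  exact: hf1.
exact: hg1.
Qed.

End Euclidean.

(* The values of [chart c] outside [cdom c] and of [chart_inv c] outside
   [chart c @` cdom c] are junk. *)
Structure manifold (R : realType) := Manifold {
  mspace :> topologicalType;
  mdim : nat;
  m_hausdorff : hausdorff_space mspace;
  m_second_countable : @second_countable mspace;
  cindex : Type;
  cdom : cindex -> set mspace;
  chart : cindex -> mspace -> 'rV[R]_mdim;
  chart_inv : cindex -> 'rV[R]_mdim -> mspace;
  cdom_open : forall c, open (cdom c);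
  cdom_cover : forall x, exists c, cdom c x;
  ccod_open : forall c, open (chart c @` cdom c);
  chartK : forall c x, cdom c x -> chart_inv c (chart c x) = x;
  chart_continuous : forall c x, cdom c x -> {for x, continuous (chart c)};
  chart_inv_continuous : forall c p, (chart c @` cdom c) p ->
    {for p, continuous (chart_inv c)};
  chart_transition : forall c d (a : 'I_mdim),
    Cinfty (chart c @` (cdom c `&` cdom d))
           (fun p => chart d (chart_inv c p) 0 a)
}.

Section SmoothFunctions.
Variables (R : realType) (M : manifold R).
Implicit Types (U V : set M) (f g : M -> R).

(* Meaningful for open [U]. *)
Definition smooth_on U f : Prop :=
  forall c, Cinfty (chart c @` (U `&` cdom c)) (f \o chart_inv c).

Lemma chart_open U c : open U -> open (chart c @` (U `&` cdom c)).
Proof.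
move=> oU; rewrite openE => _ [x [Ux cx] <-].
have cx' : (chart c @` cdom c) (chart c x) by exists x.
have h1 : \forall p \near chart c x, (chart c @` cdom c) p.
  by apply: open_nbhs_nbhs; split => //; exact: ccod_open.
have h2 : \forall p \near chart c x, U (chart_inv c p).
  apply: (chart_inv_continuous cx'); rewrite chartK//.
  exact: open_nbhs_nbhs.
near=> p; have [] : (chart c @` cdom c) p by near: p.
move=> y cy yp; exists y => //; split=> //.
by rewrite -(chartK cy) yp; near: p.
Unshelve. all: by end_near. Qed.

Lemma smooth_on_local U f :
  (forall x, U x -> exists V, V x /\ smooth_on V f) -> smooth_on U f.
Proof.
move=> h c k; apply/Ck_pointwise => _ [x [Ux cx] <-].
have [V [Vx Vf]] := h x Ux.
by apply: Ck_sub (Vf c k) => _ ->; exists x.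
Qed.

Lemma smooth_on_sub U V f : U `<=` V -> smooth_on V f -> smooth_on U f.
Proof. by move=> UV h; apply: smooth_on_local => x Ux; exists V; split => //; exact: UV. Qed.

Lemma smooth_on_eq U f g : open U -> (forall x, U x -> f x = g x) ->
  smooth_on U f -> smooth_on U g.
Proof.
move=> oU fg h c k; apply: Ck_near (h c k) => p pU.
have : \forall q \near p, (chart c @` (U `&` cdom c)) q.
  by apply: open_nbhs_nbhs; split => //; exact: chart_open.
by apply: filterS => _ [x [Ux cx] <-] /=; rewrite chartK// fg.
Qed.

Lemma smooth_on_cst U a : smooth_on U (cst a).
Proof. by move=> c k; exact: Ck_cst. Qed.

Lemma smooth_onD U f g : open U ->
  smooth_on U f -> smooth_on U g -> smooth_on U (f + g).
Proof. by move=> oU hf hg c k; apply: CkD (hf c k) (hg c k); exact: chart_open. Qed.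

Lemma smooth_onM U f g : open U ->
  smooth_on U f -> smooth_on U g -> smooth_on U (f * g).
Proof. by move=> oU hf hg c k; apply: CkM (hf c k) (hg c k); exact: chart_open. Qed.

Lemma smooth_on_sum U (I : finType) (F : I -> M -> R) : open U ->
  (forall i, smooth_on U (F i)) -> smooth_on U (fun x => \sum_i F i x).
Proof.
move=> oU h; rewrite (_ : (fun _ => _) = \sum_i F i); last first.
  by apply/funext => x; rewrite fct_sumE.
elim/big_ind: _ => //; first exact: smooth_on_cst.
by move=> f g; exact: smooth_onD.
Qed.

Definition smooth_pred : {pred M -> R} := fun f => `[< smooth_on setT f >].

Lemma smooth_pred_subring : subring_closed smooth_pred.
Proof.
split=> [|f g /asboolP hf /asboolP hg|f g /asboolP hf /asboolP hg].
- by apply/asboolP; exact: smooth_on_cst.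
- apply/asboolP; apply: smooth_onD hf _; first exact: openT.
  rewrite (_ : - g = cst (-1) * g); last first.
    by apply/funext => x; rewrite !fctE mulN1r.
  by apply: smooth_onM hg; [exact: openT|exact: smooth_on_cst].
- by apply/asboolP; apply: smooth_onM; first exact: openT.
Qed.
HB.instance Definition _ :=
  GRing.isSubringClosed.Build (M -> R) smooth_pred smooth_pred_subring.

End SmoothFunctions.

Record smoothfun (R : realType) (M : manifold R) := SmoothFun {
  smoothfun_val :> M -> R;
  smoothfun_valP : smoothfun_val \in @smooth_pred R M
}.

Section SmoothFunRing.
Variables (R : realType) (M : manifold R).
HB.instance Definition _ := [isSub for (@smoothfun_val R M)].
HB.instance Definition _ := [Choice of smoothfun M by <:].
HB.instance Definition _ :=
  GRing.SubChoice_isSubComPzRing.Build (M -> R) (@smooth_pred R M)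
    (smoothfun M) (@smooth_pred_subring R M).

Lemma smoothfunP (f : smoothfun M) : smooth_on setT f.
Proof. exact/asboolP/smoothfun_valP. Qed.

Definition to_smoothfun (f : M -> R) (h : smooth_on setT f) : smoothfun M :=
  SmoothFun (asboolT h).

Definition constf (a : R) : smoothfun M := to_smoothfun (smooth_on_cst setT a).

End SmoothFunRing.
Section Tangent.
Variables (R : realType) (M : manifold R) (x : M).

(* Tangent vectors at [x] are the R-linear derivations at [x] of the ring of
   smooth functions. *)
Record is_derivation (v : smoothfun M -> R^o) : Prop := {
  derivation_linear : forall a f g, v (constf M a * f + g) = a * v f + v g;
  derivation_leibniz : forall f g, v (f * g) = f x * v g + g x * v f
}.

Definition derivation_pred : {pred smoothfun M -> R^o} :=
  fun v => `[< is_derivation v >].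

Lemma derivation_submod : submod_closed derivation_pred.
Proof.
split=> [|a v w /asboolP[hv1 hv2] /asboolP[hw1 hw2]].
  by apply/asboolP; rewrite (_ : 0 = cst 0)//; split=> *; rewrite /cst !mulr0 addr0.
apply/asboolP; split=> [b f g|f g]; rewrite !fctE.
  rewrite hv1 hw1 !scalerDr mulrDr addrACA; congr (_ + _).
  by congr (_ + _); rewrite /GRing.scale /= mulrCA.
rewrite hv2 hw2 !scalerDr !mulrDr addrACA.
by congr (_ + _ + (_ + _)); rewrite /GRing.scale /= mulrCA.
Qed.
HB.instance Definition _ := GRing.isSubmodClosed.Build R
  (smoothfun M -> R^o) derivation_pred derivation_submod.

Record tangent := Tangent {
  tangent_val :> smoothfun M -> R^o;
  tangent_valP : tangent_val \in derivation_pred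
}.
HB.instance Definition _ := [isSub for tangent_val].
HB.instance Definition _ := [Choice of tangent by <:].
HB.instance Definition _ := [SubChoice_isSubLmodule of tangent by <:].

End Tangent.

(* A bundle is given by its fibres and a vector bundle atlas with smooth
   transition functions; the values of [triv i x] and [frame i x] for [x]
   outside [vdom i] are junk. The vectors [frame i x (delta_mx 0 b)] form the
   local frame over [vdom i] associated with the trivialization [i]. *)
Structure vbundle (R : realType) (M : manifold R) := VBundle {
  fibre :> M -> lmodType R;
  vrank : nat;
  vindex : Type;
  vdom : vindex -> set M;
  triv : forall (i : vindex) (x : M), {linear fibre x -> 'rV[R]_vrank};
  frame : forall (i : vindex) (x : M), 'rV[R]_vrank -> fibre x;
  vdom_open : forall i, open (vdom i);
  vdom_cover : forall x, exists i, vdom i x;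
  trivK : forall i x, vdom i x -> cancel (triv i x) (frame i x);
  frameK : forall i x, vdom i x -> cancel (frame i x) (triv i x);
  triv_transition : forall i j (v : 'rV[R]_vrank) (a : 'I_vrank),
    smooth_on (vdom i `&` vdom j) (fun x => triv j x (frame i x v) 0 a)
}.

Arguments vdom {R M} _ _.
Arguments triv {R M} _ _ _.
Arguments frame {R M} _ _ _.
Arguments vdom_open {R M} _ _.

Section Sections.
Variables (R : realType) (M : manifold R) (E : vbundle M).

(* Meaningful for open [U]. *)
Definition smooth_section_on (U : set M) (s : forall x, E x) : Prop :=
  forall j a, smooth_on (U `&` vdom E j) (fun x => triv E j x (s x) 0 a).

Record sections := Sections {
  sections_val :> forall x, E x;
  sectionsP : smooth_section_on setT sections_val
}.

Lemma sections_eq (s t : sections) : (forall x, s x = t x) -> s = t.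
Proof.
case: s t => [s hs] [t ht] /= st.
have {}st : s = t by exact: functional_extensionality_dep.
by case: _ / st in ht *; congr Sections; exact: Prop_irrelevance.
Qed.

Lemma zero_sectionP : smooth_section_on setT (fun x => 0 : E x).
Proof.
move=> j a; rewrite (_ : (fun _ => _) = cst 0); first exact: smooth_on_cst.
by apply/funext => x; rewrite linear0 mxE.
Qed.

Lemma add_sectionP (s t : sections) : smooth_section_on setT (fun x => s x + t x).
Proof.
move=> j a.
have oU : open ([set: M] `&` vdom E j) by rewrite setTI; exact: vdom_open.
have := smooth_onD oU (sectionsP s j a) (sectionsP t j a).
by apply: smooth_on_eq => // x _; rewrite linearD mxE.
Qed.

Lemma scale_sectionP (f : smoothfun M) (s : sections) :
  smooth_section_on setT (fun x => f x *: s x).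
Proof.
move=> j a.
have oU : open ([set: M] `&` vdom E j) by rewrite setTI; exact: vdom_open.
have hf : smooth_on ([set: M] `&` vdom E j) f.
  by apply: smooth_on_sub (smoothfunP f).
have := smooth_onM oU hf (sectionsP s j a).
by apply: smooth_on_eq => // x _; rewrite linearZ mxE.
Qed.

Definition zero_section := Sections zero_sectionP.
Definition add_section s t := Sections (add_sectionP s t).
Definition scale_section f s := Sections (scale_sectionP f s).
Definition opp_section := scale_section (-1).

HB.instance Definition _ := gen_eqMixin sections.
HB.instance Definition _ := gen_choiceMixin sections.

Fact add_sectionA : associative add_section.
Proof. by move=> s t u; apply: sections_eq => x /=; rewrite addrA. Qed.
Fact add_sectionC : commutative add_section.
Proof. by move=> s t; apply: sections_eq => x /=; rewrite addrC. Qed.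
Fact add_0section : left_id zero_section add_section.
Proof. by move=> s; apply: sections_eq => x /=; rewrite add0r. Qed.
Fact add_Nsection : left_inverse zero_section opp_section add_section.
Proof. by move=> s; apply: sections_eq => x /=; rewrite scaleN1r addNr. Qed.

HB.instance Definition _ := GRing.isZmodule.Build sections
  add_sectionA add_sectionC add_0section add_Nsection.

Fact scale_sectionA f g s :
  scale_section f (scale_section g s) = scale_section (f * g) s.
Proof. by apply: sections_eq => x /=; rewrite scalerA. Qed.
Fact scale_1section : left_id 1 scale_section.
Proof. by move=> s; apply: sections_eq => x /=; rewrite scale1r. Qed.
Fact scale_sectionDr : right_distributive scale_section +%R.
Proof. by move=> f s t; apply: sections_eq => x /=; rewrite scalerDr. Qed.
Fact scale_sectionDl s : {morph scale_section^~ s : f g / f + g}.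
Proof. by move=> f g; apply: sections_eq => x /=; rewrite scalerDl. Qed.

HB.instance Definition _ := GRing.Zmodule_isLmodule.Build
  (smoothfun M) sections
  scale_sectionA scale_1section scale_sectionDr scale_sectionDl.

Definition coord i (s : forall x, E x) (b : 'I_(vrank E)) (x : M) : R :=
  triv E i x (s x) 0 b.

Lemma frame_linear i x : vdom E i x -> linear (frame E i x).
Proof.
move=> ix a u v; apply: (can_inj (trivK ix)).
by rewrite linearP !frameK.
Qed.

Lemma section_frame i (s : forall x, E x) x : vdom E i x ->
  s x = \sum_b coord i s b x *: frame E i x (delta_mx 0 b).
Proof.
move=> ix; apply: (can_inj (trivK ix)).
rewrite linear_sum [LHS]row_sum_delta; apply: eq_bigr => b _.
by rewrite linearZ /= frameK.
Qed.

End Sections.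

Structure bundle_hom (R : realType) (M : manifold R) (E F : vbundle M) :=
  BundleHom {
    hom_fibre : forall x, {linear E x -> F x};
    hom_smooth : forall i v,
      smooth_section_on (E := F) (vdom E i)
        (fun x => hom_fibre x (frame E i x v))
  }.

(* Smooth sections of [F^* (x) F^* (x) E]. *)
Structure bilinear_map (R : realType) (M : manifold R) (F E : vbundle M) :=
  BilinearMap {
    bil_fibre : forall x, F x -> F x -> E x;
    bil_linearl : forall x (w : F x), linear (fun u : F x => bil_fibre u w);
    bil_linearr : forall x (u : F x), linear (bil_fibre u);
    bil_smooth : forall i v w,
      smooth_section_on (E := E) (vdom F i)
        (fun x => bil_fibre (frame F i x v) (frame F i x w))
  }.

Section Application.
Variables (R : realType) (M : manifold R) (E F : vbundle M).

Lemma hom_appP (K : bundle_hom E F) (s : sections E) :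
  smooth_section_on setT (fun x => hom_fibre K x (s x)).
Proof.
move=> j a; apply: smooth_on_local => x [_ jx].
have [i ix] := vdom_cover E x; exists (vdom E i `&` vdom F j); split=> //.
have oU : open (vdom E i `&` vdom F j) by apply: openI; exact: vdom_open.
have : smooth_on (vdom E i `&` vdom F j) (fun y => \sum_b
    (coord i s b * (fun y => triv F j y
      (hom_fibre K y (frame E i y (delta_mx 0 b))) 0 a)) y).
  apply: smooth_on_sum => // b; apply: smooth_onM => //.
    by apply: smooth_on_sub (sectionsP s i b) => y [].
  exact: hom_smooth.
apply: smooth_on_eq => // y [iy jy]; rewrite [in RHS](section_frame s iy).
by rewrite !linear_sum summxE; apply: eq_bigr => b _; rewrite !linearZ !mxE.
Qed.

Definition hom_app (K : bundle_hom E F) (s : sections E) : sections F :=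
  Sections (hom_appP K s).

Lemma bil_appP (B : bilinear_map F E) (s t : sections F) :
  smooth_section_on setT (fun x => bil_fibre B (s x) (t x)).
Proof.
move=> j a; apply: smooth_on_local => x [_ jx].
have [i ix] := vdom_cover F x; exists (vdom F i `&` vdom E j); split=> //.
have oU : open (vdom F i `&` vdom E j) by apply: openI; exact: vdom_open.
have : smooth_on (vdom F i `&` vdom E j) (fun y => \sum_b \sum_c
    (coord i s b * (coord i t c * (fun y => triv E j y
      (bil_fibre B (frame F i y (delta_mx 0 b))
                   (frame F i y (delta_mx 0 c))) 0 a))) y).
  apply: smooth_on_sum => // b; apply: smooth_on_sum => // c.
  apply: smooth_onM => //.
    by apply: smooth_on_sub (sectionsP s i b) => y [].
  apply: smooth_onM => //.
    by apply: smooth_on_sub (sectionsP t i c) => y [].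
  exact: bil_smooth.
apply: smooth_on_eq => // y [iy jy].
rewrite [in RHS](section_frame s iy) [in RHS](section_frame t iy).
pose lin u : {linear F y -> E y} :=
  HB.pack (bil_fibre B u)
   (GRing.isLinear.Build R (F y) (E y) *:%R (bil_fibre B u) (bil_linearr B u)).
pose linl w : {linear F y -> E y} :=
  HB.pack (fun u => bil_fibre B u w)
   (GRing.isLinear.Build R (F y) (E y) *:%R (fun u => bil_fibre B u w)
      (bil_linearl B w)).
rewrite -[bil_fibre B _ _]/(linl _ _) linear_sum linear_sum summxE.
apply: eq_bigr => b _; rewrite linearZ linearZ mxE /=.
rewrite -[bil_fibre B _ _]/(lin _ _) linear_sum linear_sum summxE mulr_sumr.
by apply: eq_bigr => c _; rewrite linearZ linearZ mxE.
Qed.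

Definition bil_app (B : bilinear_map F E) (s t : sections F) : sections E :=
  Sections (bil_appP B s t).

End Application.

Coercion hom_app : bundle_hom >-> Funclass.
Coercion bil_app : bilinear_map >-> Funclass.

(* Smooth sections of [Lambda^2 F^* (x) E]. *)
Structure two_form (R : realType) (M : manifold R) (F E : vbundle M) :=
  TwoForm {
    form_map :> bilinear_map F E;
    form_alternating : forall x (u : F x), bil_fibre form_map u u = 0
  }.

(* The tensor field of Lie brackets on the fibres of a bundle of Lie
   algebras. *)
Structure lie_bracket_field (R : realType) (M : manifold R) (E : vbundle M) :=
  LieBracketField {
    field_map :> bilinear_map E E;
    field_alternating : forall x (u : E x), bil_fibre field_map u u = 0;
    field_jacobi : forall x (u v w : E x),
      bil_fibre field_map u (bil_fibre field_map v w) +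
      bil_fibre field_map v (bil_fibre field_map w u) +
      bil_fibre field_map w (bil_fibre field_map u v) = 0
  }.

(* Vector bundle morphisms to the tangent bundle. A vector field [X] on an open
   subset is smooth iff [X f] is smooth there for every global smooth [f]. *)
Structure anchor_map (R : realType) (M : manifold R) (E : vbundle M) :=
  AnchorMap {
    anchor_fibre : forall x, {linear E x -> tangent x};
    anchor_smooth : forall i v f,
      smooth_on (vdom E i) (fun x => anchor_fibre x (frame E i x v) f)
  }.

Section AnchorApp.
Variables (R : realType) (M : manifold R) (E : vbundle M) (rho : anchor_map E).

Lemma anchor_appP (s : sections E) (f : smoothfun M) :
  smooth_on setT (fun x => anchor_fibre rho x (s x) f).
Proof.
apply: smooth_on_local => x _.
have [i ix] := vdom_cover E x; exists (vdom E i); split=> //.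
have oU := vdom_open E i.
have : smooth_on (vdom E i) (fun y => \sum_b (coord i s b *
    (fun y => anchor_fibre rho y (frame E i y (delta_mx 0 b)) f)) y).
  apply: smooth_on_sum => // b; apply: smooth_onM => //.
    by apply: smooth_on_sub (sectionsP s i b) => y iy; split.
  exact: anchor_smooth.
apply: smooth_on_eq => // y iy; rewrite [in RHS](section_frame s iy).
rewrite linear_sum -[RHS]/((val (\sum_b _)) f) raddf_sum fct_sumE.
by apply: eq_bigr => b _; rewrite linearZ.
Qed.

Definition anchor_deriv (s : sections E) (f : smoothfun M) : smoothfun M :=
  to_smoothfun (anchor_appP s f).

End AnchorApp.

(* R-bilinearity of the bracket follows from [bracket_linearr] and
   [bracket_antisym]; that the anchor preserves brackets follows from
   [bracket_jacobi] and [bracket_leibniz]. *)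
Structure lie_algebroid (R : realType) (M : manifold R) (E : vbundle M) :=
  LieAlgebroid {
    anchor : anchor_map E;
    bracket : sections E -> sections E -> sections E;
    bracket_linearr : forall mu (a : R) nu la,
      bracket mu (constf M a *: nu + la) =
      constf M a *: bracket mu nu + bracket mu la;
    bracket_antisym : forall mu nu, bracket mu nu = - bracket nu mu;
    bracket_jacobi : forall mu nu la,
      bracket mu (bracket nu la) + bracket nu (bracket la mu) +
      bracket la (bracket mu nu) = 0;
    bracket_leibniz : forall mu (f : smoothfun M) nu,
      bracket mu (f *: nu) =
      f *: bracket mu nu + anchor_deriv anchor mu f *: nu
  }.

Record lie_algebroid_morphism (R : realType) (M : manifold R)
    (E F : vbundle M) (LE : lie_algebroid E) (LF : lie_algebroid F)
    (K : bundle_hom E F) : Prop := {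
  morphism_anchor : forall x (e : E x),
    anchor_fibre (anchor LF) x (hom_fibre K x e) =
    anchor_fibre (anchor LE) x e;
  morphism_bracket : forall mu nu : sections E,
    K (bracket LE mu nu) = bracket LF (K mu) (K nu)
}.

Section Connections.
Variables (R : realType) (M : manifold R) (E F : vbundle M).
Variable (LF : lie_algebroid F).
Implicit Types (nabla : sections F -> sections E -> sections E).
Implicit Types (zeta : two_form F E) (X Y Z : sections F) (mu nu : sections E).

(* [sections E] is a module over the ring [smoothfun M]; linearity over R is
   linearity with respect to the constant functions [constf M a]. *)
Record is_connection nabla : Prop := {
  connection_linearl : forall (f : smoothfun M) X Y mu,
    nabla (f *: X + Y) mu = f *: nabla X mu + nabla Y mu;
  connection_linearr : forall X (a : R) mu nu,
    nabla X (constf M a *: mu + nu) = constf M a *: nabla X mu + nabla X nu;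
  connection_leibniz : forall X (f : smoothfun M) mu,
    nabla X (f *: mu) = f *: nabla X mu + anchor_deriv (anchor LF) X f *: mu
}.

Definition curvature nabla X Y mu : sections E :=
  nabla X (nabla Y mu) - nabla Y (nabla X mu) - nabla (bracket LF X Y) mu.

Definition ext_deriv nabla zeta X Y Z : sections E :=
  (nabla X (zeta Y Z) - zeta (bracket LF X Y) Z) +
  (nabla Y (zeta Z X) - zeta (bracket LF Y Z) X) +
  (nabla Z (zeta X Y) - zeta (bracket LF Z X) Y).

Record strict_YM_connection (H : lie_bracket_field E) nabla zeta : Prop := {
  YM_connection : is_connection nabla;
  YM_parallel : forall X mu nu,
    nabla X (H mu nu) = H (nabla X mu) nu + H mu (nabla X nu);
  YM_curvature : forall X Y nu, curvature nabla X Y nu = H (zeta X Y) nu;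
  YM_strict : forall X Y Z, ext_deriv nabla zeta X Y Z = 0
}.

(* The connection written [nabla^zeta]. *)
Definition conn_zeta (K : bundle_hom E F) nabla zeta X nu : sections E :=
  nabla X nu - zeta X (K nu).

Definition twisted_bracket (K : bundle_hom E F) (H : lie_bracket_field E)
    nabla zeta mu nu : sections E :=
  H mu nu + nabla (K mu) nu - nabla (K nu) mu + zeta (K mu) (K nu).

(* [LE] is the [K]-twisted action algebroid induced by [H] and
   [(nabla, zeta)]: this prescribes all the data of [LE]. *)
Record is_twisted_action_algebroid (LE : lie_algebroid E) (K : bundle_hom E F)
    (H : lie_bracket_field E) nabla zeta : Prop := {
  twisted_anchor : forall x (e : E x),
    anchor_fibre (anchor LE) x e =
    anchor_fibre (anchor LF) x (hom_fibre K x e);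
  twisted_bracketE : forall mu nu,
    bracket LE mu nu = twisted_bracket K H nabla zeta mu nu
}.

End Connections.

Section Adjustments.
Variables (R : realType) (M : manifold R) (E F : vbundle M).
Variables (LE : lie_algebroid E) (LF : lie_algebroid F) (K : bundle_hom E F).
Implicit Types (nabla : sections F -> sections E -> sections E).
Implicit Types (zeta : two_form F E) (X Y Z : sections F) (mu nu : sections E).

Definition basic_E nabla mu nu : sections E :=
  bracket LE mu nu + nabla (K nu) mu.

Definition basic_F nabla mu X : sections F :=
  bracket LF (K mu) X + K (nabla X mu).

Definition torsion (nablaE : sections E -> sections E -> sections E) mu nu :=
  nablaE mu nu - nablaE nu mu - bracket LE mu nu.

Record cartan_connection nabla : Prop := {
  cartan_is_connection : is_connection LF nabla;
  cartan_identity : forall mu nu X,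
    nabla X (bracket LE mu nu) - bracket LE (nabla X mu) nu
    - bracket LE mu (nabla X nu) - nabla (basic_F nabla nu X) mu
    + nabla (basic_F nabla mu X) nu = 0
}.

Record strict_adjustment nabla zeta : Prop := {
  adjustment_cartan : cartan_connection nabla;
  (* [R_nabla = - d^{nabla^bas} zeta] *)
  adjustment_curvature : forall X Y nu,
    curvature LF nabla X Y nu =
    - basic_E nabla nu (zeta X Y) + zeta (basic_F nabla nu X) Y
    + zeta X (basic_F nabla nu Y);
  adjustment_strict : forall X Y Z,
    ext_deriv LF (conn_zeta K nabla zeta) zeta X Y Z = 0
}.

End Adjustments.

(* Main.v *)
From HB Require Import structures.
Require Import Defs.
From mathcomp Require Import all_boot all_order all_algebra.
From mathcomp Require Import all_classical all_reals all_analysis.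
From mathcomp Require Import ring lra.

Set Implicit Arguments.
Unset Strict Implicit.
Unset Printing Implicit Defensive.

Import Order.TTheory GRing.Theory Num.Theory.
Import numFieldNormedType.Exports.

Local Open Scope ring_scope.

(** Why the theorem is true. Write [D] for the connection [nabla^zeta], so that
[nabla_X s = D_X s + zeta(X, K s)]. Unfolding the torsion shows that the formula
for [H] and the formula for the bracket of the twisted action algebroid are the
same equation, solved for [H] or for the bracket. Given this equation, that [K]
preserves brackets and [d^D zeta = 0], there are three identities:
- the defect of the adjustment equation [R_nabla = - d^{nabla^bas} zeta] is the
  defect of [R_D = H(zeta, _)] ([twisted_curvature]);
- if [R_D = H(zeta, _)], the defect of the Cartan identity for [nabla] is the
  defect of [D H = 0] ([twisted_cartan]);
- if moreover [D H = 0], the Jacobiators of the bracket and of [H] agree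
  ([twisted_jacobi]).
The first two turn adjustments into YM connections and back; the third gives the
Jacobi identity of [H] in one direction and of the twisted bracket in the other.

All three are identities between additive expressions in sections. They are
proved by applying an arbitrary additive functional to real numbers, after which
they are linear consequences of the hypotheses; the coordinates in local
trivializations are enough functionals to separate sections
([sections_separated]).

What remains is that the operation [H] built from the torsion, which is defined
on global sections, comes from a tensor field. The Leibniz terms cancel, so it
is bilinear over smooth functions, and such a map is tensorial
([bilinear_tensor]). Here global sections have to be compared with vectors in
single fibres and with local frames, which takes bump functions
([bump_function]). They are made from [exp(-1/t)]: its derivatives are
combinations of the functions [flat m], whose span is closed under
differentiation. *)

(** * Flat functions *)

Section FlatFunction.
Variable R : realType.
Implicit Types (t : R) (m : nat).
Local Open Scope classical_set_scope.

(** [t^(-m) exp(-1/t)], extended by zero to [t <= 0]. The powers are there because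
differentiating [exp(-1/t)] produces them. *)
Definition flat m t : R := if 0 < t then t^-1 ^+ m * expR (- t^-1) else 0.

Lemma flat_pos t : 0 < t -> 0 < flat 0 t.
Proof. by move=> t0; rewrite /flat t0 expr0 mul1r expR_gt0. Qed.

Lemma flat_neg m t : t <= 0 -> flat m t = 0.
Proof. by rewrite /flat ltNge => ->. Qed.

(** With [s = 1/t] this is [s^m exp(-s) <= C s^(-2)], and follows from
[1 + x <= exp x] at [x = s/(m+2)], raised to the power [m+2]. The square makes
[flat m] differentiable at [0] with derivative [0]. *)
Lemma flat_bound m t : 0 < t -> flat m t <= (m.+2)%:R ^+ m.+2 * t ^+ 2.
Proof.
move=> t0; rewrite /flat t0; set N : R := _%:R.
have N0 : 0 < N by rewrite ltr0n.
have s0 : 0 < t^-1 by rewrite invr_gt0.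
have : (t^-1 / N) ^+ m.+2 <= expR t^-1.
  have -> : expR t^-1 = expR (t^-1 / N) ^+ m.+2.
    by rewrite -expRM_natl; congr expR; rewrite mulrC divfK// gt_eqF.
  apply: lerXn2r; rewrite ?nnegrE ?expR_ge0// ?divr_ge0 ?ltW//.
  by apply: lt_le_trans (expR_ge1Dx _); rewrite ltrDr.
rewrite expRN ler_pdivrMr ?expR_gt0// => h.
have -> : t^-1 ^+ m = N ^+ m.+2 * t ^+ 2 * (t^-1 / N) ^+ m.+2.
  have tN : t * t^-1 = 1 by rewrite divff ?gt_eqF.
  have NN : N ^+ m.+2 * N^-1 ^+ m.+2 = 1.
    by rewrite -exprMn divff ?expr1n ?gt_eqF.
  have -> : N ^+ m.+2 * t ^+ 2 * (t^-1 / N) ^+ m.+2 =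
      (N ^+ m.+2 * N^-1 ^+ m.+2) * (t * t^-1) ^+ 2 * t^-1 ^+ m.
    rewrite (exprMn _ t^-1) (exprMn _ t); move: (t^-1) (N^-1) => a b.
    by rewrite !(exprS a); ring.
  by rewrite NN tN expr1n !mul1r.
by rewrite ler_pM2l// mulr_gt0 ?exprn_gt0.
Qed.

Lemma is_derive_flat m t :
  is_derive t (1 : R) (flat m) (- m%:R * flat m.+1 t + flat m.+2 t).
Proof.
have [t0|t0|->] := ltgtP t 0.
- have zero : \forall s \near t, cst 0 s = flat m s.
    by near=> s; rewrite flat_neg// ltW//; near: s; exact: lt_nbhsl.
  apply: near_eq_is_derive zero _.
  by rewrite !(flat_neg _ (ltW t0)) mulr0 addr0; exact: is_derive_cst.
- have pos : \forall s \near t,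
      ((fun s : R => s^-1) ^+ m * (expR \o (fun s : R => - s^-1))) s = flat m s.
    near=> s; rewrite /flat ifT; last by near: s; exact: lt_nbhsr.
    by rewrite !fctE.
  apply: near_eq_is_derive pos _.
  have tV : is_derive t 1 (fun s : R => s^-1) (- t ^- 2 *: 1).
    by apply: (@is_deriveV R id); rewrite ?gt_eqF.
  have dX := @is_deriveX _ _ (fun s : R => s^-1) m t 1 _ tV.
  have dE := @is_derive1_comp _ expR (fun s : R => - s^-1) t _ _
    (is_derive_expR _) (@is_deriveN _ _ _ _ _ _ _ tV).
  apply: is_derive_eq (is_deriveM dX dE) _.
  rewrite /flat t0 /GRing.scale /= !mulr1 opprK fctE -!exprVn.
  by case: m {dX} => [|m]; rewrite /= ?exprS; ring.
- have bound s : `|flat m s| <= (m.+2)%:R ^+ m.+2 * `|s| ^+ 2.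
    have [s0|s0] := leP s 0.
      by rewrite flat_neg// normr0 mulr_ge0 ?exprn_ge0.
    rewrite ger0_norm ?(gtr0_norm s0); first exact: flat_bound.
    by rewrite /flat s0 mulr_ge0 ?expR_ge0 ?exprn_ge0 ?invr_ge0 ?ltW.
  have cv : (fun h => h^-1 *: ((flat m \o shift 0) (h *: 1) - flat m 0)) @ 0^'
      --> (0 : R).
    apply/cvgr0Pnorm_le => eps eps0.
    set C : R := (m.+2)%:R ^+ m.+2 in bound.
    have C0 : 0 < C by rewrite exprn_gt0 ?ltr0n.
    near=> h; rewrite /= (flat_neg m (lexx 0)) subr0 addr0 [_ *: 1]mulr1.
    have h0 : 0 < `|h| by rewrite normr_gt0; near: h; exact: nbhs_dnbhs_neq.
    rewrite normrZ normfV mulrC ler_pdivrMr//.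
    apply: le_trans (bound h) _; rewrite expr2 mulrA ler_pM2r// mulrC -ler_pdivlMr//.
    near: h; apply: dnbhs0_le; exact: divr_gt0.
  rewrite !(flat_neg _ (lexx 0)) mulr0 addr0.
  by split; [apply/cvg_ex; exists 0|exact/cvg_lim].
Unshelve. all: by end_near. Qed.

End FlatFunction.

(** * Composition of smooth functions *)

Section Chain.
Variables (R : realType) (n : nat).
Implicit Types (W : set 'rV[R]_n) (f g : 'rV[R]_n -> R).
Local Open Scope classical_set_scope.

(** The chain rule in the form that an induction on [k] needs: the derivative
[phi'] is only asked to be [C^k] along [f], so functions [phi] whose span is
closed under differentiation can be treated simultaneously. *)
Lemma Ck_comp k W f (phi phi' : R -> R) : open W ->
  (forall p, W p -> is_derive (f p) (1 : R) phi (phi' (f p))) ->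
  Ck k.+1 W f -> Ck k W (phi' \o f) -> Ck k.+1 W (phi \o f).
Proof.
move=> oW dphi Cf Cphi'; have kf := Ck_pred Cf; case: Cf => df Cdf.
have dphif p : W p -> differentiable phi (f p).
  by move=> Wp; apply/derivable1_diffP; exact: (@ex_derive _ _ _ _ _ _ _ (dphi p Wp)).
split=> [p Wp|v]; first by apply: differentiable_comp; [exact: df|exact: dphif].
apply: Ck_near (CkM oW Cphi' (Cdf v)) => p Wp.
have : \forall q \near p, W q by exact: open_nbhs_nbhs.
apply: filterS => q Wq; have dq := df q Wq; have dpq := dphif q Wq.
rewrite [RHS]deriveE; last exact: differentiable_comp.
rewrite diff_comp//= -(deriveE _ dq) fctE /=; set y := 'D_v f q.
have -> : 'd phi (f q) y = y * 'd phi (f q) 1.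
  by rewrite -[y in LHS]mulr1 -[y * 1]/(y *: 1) linearZ.
by rewrite -deriveE// (@derive_val _ _ _ _ _ _ _ (dphi q Wq)) mulrC.
Qed.

Lemma Ck_inv k W f : open W -> (forall p, W p -> f p != 0) ->
  Ck k W f -> Ck k W (fun p => (f p)^-1).
Proof.
move=> oW f0; elim: k => [|k IH] Cf.
  by move=> p Wp; apply: continuousV; [exact: f0|exact: Cf].
have CV := IH (Ck_pred Cf).
apply: (@Ck_comp _ _ _ GRing.inv (fun t => - t ^- 2)) => //.
  move=> p Wp; have := @is_deriveV R id (f p) 1 1 (f0 p Wp) (is_derive_id _ _).
  by rewrite /GRing.scale /= mulr1.
rewrite (_ : _ \o _ = cst (-1) * ((fun p => (f p)^-1) * (fun p => (f p)^-1))).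
  by apply: CkM => //; [exact: Ck_cst|exact: CkM].
by apply/funext => p; rewrite /= !fctE mulN1r -exprVn expr2.
Qed.

Lemma Ck_flat k m W f : open W -> Ck k W f -> Ck k W (flat m \o f).
Proof.
move=> oW; elim: k m => [|k IH] m Cf.
  move=> p Wp; apply: continuous_comp; first exact: Cf.
  apply: differentiable_continuous; apply/derivable1_diffP.
  exact: (@ex_derive _ _ _ _ _ _ _ (is_derive_flat m (f p))).
have kf := Ck_pred Cf.
apply: (@Ck_comp _ _ _ (flat m)
  (fun t => - m%:R * flat m.+1 t + flat m.+2 t)) => // [p _|].
  exact: is_derive_flat.
exact: (CkD oW (CkM oW (Ck_cst _ _ _) (IH _ kf)) (IH _ kf)).
Qed.

End Chain.

(** * Bump functions *)

Section Bump.
Variables (R : realType) (M : manifold R).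
Implicit Types (U V W : set M) (f g : M -> R).
Local Open Scope classical_set_scope.

Lemma smooth_on_inv U f : open U -> (forall x, U x -> f x != 0) ->
  smooth_on U f -> smooth_on U (fun x => (f x)^-1).
Proof.
move=> oU f0 hf c k.
have n0 p : (chart c @` (U `&` cdom c)) p -> (f \o chart_inv c) p != 0.
  by move=> [x [Ux cx] <-] /=; rewrite chartK//; exact: f0.
exact: (Ck_inv (chart_open oU) n0 (hf c k)).
Qed.

Lemma smooth_on_flat U m f : open U -> smooth_on U f -> smooth_on U (flat m \o f).
Proof. by move=> oU hf c k; exact: Ck_flat (chart_open oU) (hf c k). Qed.

Lemma smooth_on_chart c a : smooth_on (cdom c) (fun x : M => chart c x 0 a).
Proof. by move=> d k; rewrite setIC; exact: chart_transition. Qed.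

(** Closed balls for the maximum norm, which is the norm of ['rV[R]_n]. *)
Definition box n (p : 'rV[R]_n) (r : R) : set 'rV[R]_n :=
  [set q | forall a, `|q 0 a - p 0 a| <= r].

Lemma box_compact n (p : 'rV[R]_n) r : compact (box p r).
Proof.
rewrite (_ : box p r = [set q : 'rV[R]_n |
    forall a, `[p 0 a - r, p 0 a + r]%classic (q ord0 a)]).
  apply: (@rV_compact _ _ (fun a => `[p 0 a - r, p 0 a + r]%classic)) => a.
  exact: segment_compact.
by apply/seteqP; split=> q /= h a; have := h a; rewrite ler_distl in_itv.
Qed.

Definition chart_box (c : cindex M) (p : 'rV[R]_(mdim M)) (r : R) : set M :=
  chart_inv c @` box p r.

(** The Hausdorff axiom enters here: the image of a compact box is compact, hence
closed in the whole manifold and not just in the chart domain. *)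
Lemma chart_box_closed (c : cindex M) p r :
  box p r `<=` chart c @` cdom c -> closed (chart_box c p r).
Proof.
move=> sub; apply: compact_closed; first exact: m_hausdorff.
apply: continuous_compact.
  apply: continuous_in_subspaceT => q /set_mem /sub.
  exact: chart_inv_continuous.
exact: box_compact.
Qed.

Lemma chart_box_sub c x U : open U -> U x -> cdom c x ->
  exists2 r, 0 < r & box (chart c x) r `<=` chart c @` (U `&` cdom c).
Proof.
move=> oU Ux cx.
have : nbhs (chart c x) (chart c @` (U `&` cdom c)).
  by apply: open_nbhs_nbhs; split; [exact: chart_open|exists x].
move=> /nbhs_ballP[e /= e0 sub]; exists (e / 2); first by rewrite divr_gt0.
move=> q /= hq; apply: sub; split=> // i a; rewrite (ord1 i) /ball /= distrC.
by apply: le_lt_trans (hq a) _; rewrite ltr_pdivrMr// ltr_pMr// ltr1n.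
Qed.

(** The condition on the support is stated as an open set [W] on which [chi]
vanishes and which covers the manifold together with [U]; this is the form in
which a product with [chi] is seen to be globally smooth. In a chart, [chi] is
[flat 0] of [r^2 - |p - p0|^2]. *)
Lemma bump_function U x : open U -> U x ->
  exists chi : smoothfun M, exists W,
    [/\ open W, chi x != 0, forall y, W y -> chi y = 0
      & forall y, U y \/ W y].
Proof.
move=> oU Ux; have [c cx] := cdom_cover x.
have [r r0 sub] := chart_box_sub oU Ux cx.
set p := chart c x in sub.
pose W := ~` chart_box c p r.
have oW : open W.
  apply: closed_openC; apply: chart_box_closed => q /sub [y [_ cy] <-].
  by exists y.
pose V := U `&` cdom c.
have oV : open V by apply: openI => //; exact: cdom_open.
pose q y := r ^+ 2 - \sum_a (chart c y 0 a - p 0 a) ^+ 2.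
pose chi y := if `[< V y >] then flat 0 (q y) else 0.
have VW y : V y \/ W y.
  have [Vy|nVy] := pselect (V y); [by left|right].
  move=> [z hz zy]; apply: nVy; have [t Vt tz] := sub z hz.
  by rewrite -zy -tz chartK//; case: Vt.
have chiW y : W y -> chi y = 0.
  rewrite /chi; case: asboolP => // Vy Wy; rewrite flat_neg//.
  rewrite leNgt subr_gt0; apply/negP => qy; apply: Wy.
  exists (chart c y); last by rewrite chartK//; case: Vy.
  move=> a; rewrite -(@ler_pXn2r _ 2)// ?nnegrE ?(ltW r0)// real_normK ?num_real//.
  apply: le_trans (ltW qy).
  by rewrite (bigD1 a)//= lerDl sumr_ge0// => b _; exact: sqr_ge0.
have sq : smooth_on V q.
  have sV : smooth_on V (fun y => \sum_a
      (fun y => (chart c y 0 a - p 0 a) ^+ 2) y).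
    apply: smooth_on_sum => // a.
    have h : smooth_on V ((fun y => chart c y 0 a) + cst (- p 0 a)).
      apply: smooth_onD => //; last exact: smooth_on_cst.
      by apply: smooth_on_sub (@smooth_on_chart c a) => y [].
    exact: (smooth_onM oV h h).
  have := smooth_onD oV (smooth_on_cst V (r ^+ 2))
    (smooth_onM oV (smooth_on_cst V (-1)) sV).
  by apply: smooth_on_eq => // y _; rewrite !fctE mulN1r.
have schi : smooth_on setT chi.
  apply: smooth_on_local => y _; case: (VW y) => [Vy|Wy].
    exists V; split=> //; have := smooth_on_flat 0 oV sq.
    by apply: smooth_on_eq => // z Vz; rewrite /chi asboolT.
  exists W; split=> //; have := smooth_on_cst W (0 : R).
  by apply: smooth_on_eq => // z Wz; rewrite chiW.
exists (to_smoothfun schi), W; split=> //=.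
  rewrite /chi asboolT// gt_eqF// flat_pos// /q big1 ?subr0 ?exprn_gt0// => a _.
  by rewrite subrr expr0n.
by move=> y; case: (VW y) => [[]|]; [left|right].
Qed.

(** The product needs no case distinction: outside [U] the values of [f] are junk,
but [chi] is zero there. *)
Lemma smooth_on_cutoff U W f (chi : smoothfun M) : open U -> open W ->
  (forall y, W y -> chi y = 0) -> (forall y, U y \/ W y) ->
  smooth_on U f -> smooth_on setT (fun y => chi y * f y).
Proof.
move=> oU oW chiW UW sf; apply: smooth_on_local => y _; case: (UW y) => [Uy|Wy].
  exists U; split=> //; apply: smooth_onM => //.
  by apply: smooth_on_sub (smoothfunP chi).
exists W; split=> //; have := smooth_on_cst W (0 : R).
by apply: smooth_on_eq => // z Wz; rewrite chiW ?mul0r.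
Qed.

End Bump.

(** * Tensoriality *)

Section Localization.
Variables (R : realType) (M : manifold R).
Local Open Scope classical_set_scope.

Lemma smooth_continuous (f : smoothfun M) : continuous f.
Proof.
move=> x; have [c cx] := cdom_cover x.
have cf : {for chart c x, continuous (f \o chart_inv c)}.
  by apply: (smoothfunP f c 0); exists x.
have eqf : \forall y \near x, (f \o chart_inv c) (chart c y) = f y.
  near=> y; rewrite /= chartK//; near: y.
  by apply: open_nbhs_nbhs; split=> //; exact: cdom_open.
have := @continuous_comp _ _ _ (chart c) (f \o chart_inv c) x
  (chart_continuous cx) cf.
rewrite /prop_for /continuous_at -(nbhs_singleton eqf); apply: cvg_trans.
exact: near_eq_cvg eqf.
Unshelve. all: by end_near. Qed.

Lemma open_neq0 (f : smoothfun M) : open [set x | f x != 0].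
Proof.
apply: (@open_comp _ _ f [set y : R | y != 0]) => [x _|]; last exact: open_neq.
exact: smooth_continuous.
Qed.

Lemma cutoff_frameP (E : vbundle M) i W (chi : smoothfun M) v : open W ->
  (forall y, W y -> chi y = 0) -> (forall y, vdom E i y \/ W y) ->
  smooth_section_on setT (fun y => chi y *: frame E i y v).
Proof.
move=> oW chiW UW j a; apply: smooth_on_local => y [_ jy].
case: (UW y) => [iy|Wy].
  have oV : open (vdom E i `&` vdom E j) by apply: openI; exact: vdom_open.
  exists (vdom E i `&` vdom E j); split=> //.
  have := smooth_onM oV (smooth_on_sub (@subsetT _ _) (smoothfunP chi))
    (triv_transition i j v a).
  by apply: smooth_on_eq => // z _; rewrite linearZ mxE.
exists W; split=> //; have := smooth_on_cst W (0 : R).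
by apply: smooth_on_eq => // z Wz; rewrite chiW// scale0r linear0 mxE.
Qed.

Lemma section_sumE (E : vbundle M) (I : finType) (s : I -> sections E) x :
  (\sum_i s i) x = \sum_i s i x.
Proof. exact: (big_morph (fun t : sections E => t x)). Qed.

Lemma section_through (E : vbundle M) x (u : E x) :
  exists s : sections E, s x = u.
Proof.
have [i ix] := vdom_cover E x.
have [chi [W [oW chix chiW UW]]] := bump_function (vdom_open E i) ix.
exists (constf M (chi x)^-1 *: Sections (cutoff_frameP (triv E i x u) oW chiW UW)).
by rewrite /= trivK// scalerA mulVf// scale1r.
Qed.

(** Near [x] the section is a combination of frame sections whose coefficients
vanish at [x]. Multiplying by [chi^2] makes both the coefficients and the frame
sections global, so that linearity of [T] applies. *)
Lemma linear_map_pointwise (E E' : vbundle M) (T : sections E -> sections E') :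
  linear T -> forall (s : sections E) x, s x = 0 -> T s x = 0.
Proof.
move=> linT s x sx.
pose T' : {linear sections E -> sections E'} :=
  HB.pack T (GRing.isLinear.Build _ _ _ _ T linT).
have [i ix] := vdom_cover E x.
have [chi [W [oW chix chiW UW]]] := bump_function (vdom_open E i) ix.
pose e b := Sections (cutoff_frameP (delta_mx 0 b) oW chiW UW).
have coord_smooth b : smooth_on (vdom E i) (Defs.coord i s b).
  by apply: smooth_on_sub (sectionsP s i b) => y iy; split.
pose c b := to_smoothfun
  (smooth_on_cutoff (vdom_open E i) oW chiW UW (coord_smooth b)).
have chis : (chi * chi) *: s = \sum_b c b *: e b.
  apply: sections_eq => y.
  rewrite section_sumE -[LHS]/((chi y * chi y) *: s y) /=; case: (UW y) => [iy|Wy].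
    rewrite [in LHS](section_frame s iy) scaler_sumr; apply: eq_bigr => b _.
    by rewrite !scalerA mulrAC.
  rewrite chiW// mul0r scale0r.
  by rewrite big1// => b _; rewrite mul0r scale0r.
have : ((chi * chi) *: T' s) x = 0.
  rewrite -linearZ chis linear_sum section_sumE big1// => b _.
  by rewrite (linearZ_LR T') /= /Defs.coord sx linear0 mxE mulr0 scale0r.
by move=> /eqP /=; rewrite scaler_eq0 mulf_eq0 (negbTE chix) => /eqP.
Qed.

Section Bilinear.
Variables (F E : vbundle M) (T : sections F -> sections F -> sections E).
Hypothesis linl : forall t, linear (T^~ t).
Hypothesis linr : forall s, linear (T s).

Lemma bilinear_map_pointwise (s s' t t' : sections F) x :
  s x = s' x -> t x = t' x -> T s t x = T s' t' x.
Proof.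
move=> ss tt.
have -> : s = 1 *: (s - s') + s' by rewrite scale1r subrK.
have -> : t = 1 *: (t - t') + t' by rewrite scale1r subrK.
rewrite linl !linr !scale1r.
have s0 : (s - s') x = 0 by rewrite /= scaleN1r ss subrr.
have t0 : (t - t') x = 0 by rewrite /= scaleN1r tt subrr.
rewrite /= (linear_map_pointwise (linl _) s0) (linear_map_pointwise (linl _) s0).
by rewrite (linear_map_pointwise (linr _) t0) !add0r.
Qed.

Let ext x (u : F x) : sections F := projT1 (cid (section_through u)).
Let extE x (u : F x) : ext u x = u.
Proof. by rewrite /ext; case: cid. Qed.

(* By pointwise dependence the value does not depend on the chosen extensions. *)
Let fib x (u w : F x) : E x := T (ext u) (ext w) x.

Let fibE (s t : sections F) x : fib (s x) (t x) = T s t x.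
Proof. by apply: bilinear_map_pointwise; exact: extE. Qed.

Let fib_linl x (w : F x) : linear (fun u : F x => fib u w).
Proof.
move=> a u u'.
rewrite /fib -[RHS]/((constf M a *: T (ext u) (ext w) + T (ext u') (ext w)) x).
by rewrite -linl; apply: bilinear_map_pointwise; rewrite //= !extE.
Qed.

Let fib_linr x (u : F x) : linear (fib u).
Proof.
move=> a w w'.
rewrite /fib -[RHS]/((constf M a *: T (ext u) (ext w) + T (ext u) (ext w')) x).
by rewrite -linr; apply: bilinear_map_pointwise; rewrite //= !extE.
Qed.

(* Where [chi] does not vanish, the value on two frame vectors is [chi^(-2)] times
   a value of [T] on global sections. *)
Let fib_smooth i v w : smooth_section_on (E := E) (vdom F i)
  (fun x => fib (frame F i x v) (frame F i x w)).
Proof.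
move=> j a; apply: smooth_on_local => x [ix jx].
have [chi [W [oW chix chiW UW]]] := bump_function (vdom_open F i) ix.
pose V := vdom F i `&` vdom E j `&` [set y | chi y != 0].
have oV : open V.
  by do 2?apply: openI; [exact: vdom_open|exact: vdom_open|exact: open_neq0].
exists V; split=> //.
pose s v := Sections (cutoff_frameP v oW chiW UW).
have ci : smooth_on V (fun y => (chi y)^-1).
  apply: smooth_on_inv => // [y []//|].
  exact: smooth_on_sub (@subsetT _ _) (smoothfunP chi).
have sT : smooth_on V (fun y => triv E j y (T (s v) (s w) y) 0 a).
  by apply: smooth_on_sub (sectionsP (T (s v) (s w)) j a) => y [[]].
have := smooth_onM oV ci (smooth_onM oV ci sT).
apply: smooth_on_eq => // y [_ chiy]; rewrite !fctE -fibE /=.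
pose L u : {linear F y -> E y} :=
  HB.pack (fib u) (GRing.isLinear.Build _ _ _ _ (fib u) (fib_linr u)).
pose L' u : {linear F y -> E y} :=
  HB.pack (fun t => fib t u) (GRing.isLinear.Build _ _ _ _ _ (fib_linl u)).
rewrite -[fib (_ *: _) _]/(L _ _) (linearZ_LR (L _)).
rewrite -[L _ _]/(L' _ _) (linearZ_LR (L' _)) /= !linearZ !mxE.
by rewrite !mulKf.
Qed.

Lemma bilinear_tensor : exists B : bilinear_map F E, forall s t, B s t = T s t.
Proof.
exists (BilinearMap fib_linl fib_linr fib_smooth) => s t.
by apply: sections_eq => x /=; exact: fibE.
Qed.

End Bilinear.
End Localization.

(** * The three identities *)

(** The identities only use additivity and skew-symmetry, so they are proved for
abelian groups: [VF] and [VE] stand for the sections of [F] and [E], [z] for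
[zeta], the notation [b] for the twisted bracket and [N] for the connection
[nabla]. *)
Section TwistedIdentities.
Variables (R : realType) (VF VE : zmodType).
(* With enough real functionals an equation in [VE] can be deduced from others by
   linear arithmetic over the reals. *)
Hypothesis separated : forall s t : VE,
  (forall phi : {additive VE -> R}, phi s = phi t) -> s = t.

Definition biadditive (U V W : zmodType) (f : U -> V -> W) :=
  (forall v, {morph f^~ v : u u' / u + u'}) /\
  (forall u, {morph f u : v v' / v + v'}).

Lemma morphN (U V : zmodType) (f : U -> V) :
  {morph f : u v / u + v} -> {morph f : u / - u}.
Proof.
move=> fD u; have f0 : f 0 = 0 by apply: (addrI (f 0)); rewrite -fD !addr0.
by apply/eqP; rewrite -subr_eq0 opprK -fD addNr f0.
Qed.

Lemma biadditiveNl (U V W : zmodType) (f : U -> V -> W) :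
  biadditive f -> forall u v, f (- u) v = - f u v.
Proof. by move=> [fl _] u v; rewrite (morphN (fl v)). Qed.

Lemma biadditiveNr (U V W : zmodType) (f : U -> V -> W) :
  biadditive f -> forall u v, f u (- v) = - f u v.
Proof. by move=> [_ fr] u v; rewrite (morphN (fr u)). Qed.

Lemma alternatingN (U V : zmodType) (f : U -> U -> V) :
  biadditive f -> (forall u, f u u = 0) -> forall u v, f u v = - f v u.
Proof.
move=> [fl fr] f0 u v; have := f0 (u + v).
rewrite fl !fr !f0 addr0 add0r => /eqP.
by rewrite addr_eq0 => /eqP.
Qed.

Variables (bF : VF -> VF -> VF) (K : VE -> VF) (D : VF -> VE -> VE).
Variables (z : VF -> VF -> VE) (H : VE -> VE -> VE).
Hypothesis K_add : {morph K : u v / u + v}.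
Hypotheses (D_add : biadditive D) (z_add : biadditive z) (H_add : biadditive H).
Hypotheses (bFC : forall X Y, bF X Y = - bF Y X).
Hypotheses (zC : forall X Y, z X Y = - z Y X).
Hypotheses (HC : forall u v, H u v = - H v u).

Local Notation b u v := (H u v + D (K u) v - D (K v) u + z (K u) (K v)).
Local Notation N X u := (D X u + z X (K u)).

Hypothesis Kb : forall u v, K (b u v) = bF (K u) (K v).

Local Notation curvD X Y u :=
  (D X (D Y u) - D Y (D X u) - D (bF X Y) u).
Local Notation curvN X Y u :=
  (N X (N Y u) - N Y (N X u) - N (bF X Y) u).

Hypothesis dz : forall X Y Z,
  (D X (z Y Z) - z (bF X Y) Z) + (D Y (z Z X) - z (bF Y Z) X)
  + (D Z (z X Y) - z (bF Z X) Y) = 0.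

Let addE := (D_add.1, D_add.2, z_add.1, z_add.2, H_add.1, H_add.2, K_add,
  biadditiveNl D_add, biadditiveNr D_add, biadditiveNl z_add,
  biadditiveNr z_add, biadditiveNl H_add, biadditiveNr H_add, morphN K_add).

(** Expands all terms by additivity and looks for a linear combination of the
equations that precede the goal as premises. *)
Ltac separate :=
  rewrite !addE; intros; let phi := fresh in apply: separated => phi;
  repeat match goal with h : _ = _ |- _ => move: (congr1 phi h); clear h end;
  rewrite !(raddfD phi, raddfN phi, raddf0 phi); lra.

(** The closedness of [zeta] on [X], [Y], [K u] trades the derivatives of [zeta] in
the curvature of [N] for [D (K u) (z X Y)], a term of the bracket of [u] with
[z X Y]. *)
Lemma twisted_curvature X Y u :
  curvN X Y u - (- (b u (z X Y) + N (K (z X Y)) u)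
    + z (bF (K u) X + K (N X u)) Y + z X (bF (K u) Y + K (N Y u)))
  = curvD X Y u - H (z X Y) u.
Proof.
move: (dz X Y (K u)).
rewrite (bFC Y (K u)) !(zC (K u) X).
move: (HC u (z X Y)) (zC (K u) (K (z X Y))) (zC X (bF (K u) Y)).
move: (zC (K (D X u)) Y) (zC (K (z X (K u))) Y).
separate.
Qed.

Hypothesis curvDE : forall X Y u, curvD X Y u = H (z X Y) u.

(** The second derivatives combine to the curvatures of [D] at [(X, K u)] and
[(X, K v)], the derivatives of [zeta] to its closedness on [X], [K u], [K v]. *)
Lemma twisted_cartan u v X :
  N X (b u v) - b (N X u) v - b u (N X v)
    - N (bF (K v) X + K (N X v)) u + N (bF (K u) X + K (N X u)) v
  = D X (H u v) - H (D X u) v - H u (D X v).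
Proof.
(* [K] is applied to a bracket here; replacing it by the bracket of [VF] has to
   come before expanding the bracket. *)
have -> : N X (b u v) = D X (b u v) + z X (bF (K u) (K v)) by rewrite -Kb.
move: (dz X (K u) (K v)) (curvDE X (K u) v) (curvDE X (K v) u).
rewrite !(bFC X) !(zC (K v) X) (zC (bF (K u) (K v))).
move: (HC u (z X (K v))) (zC (K u) (K (D X v))) (zC (K u) (K (z X (K v)))).
separate.
Qed.

Hypothesis DH : forall X u v, D X (H u v) = H (D X u) v + H u (D X v).

(** The second derivatives combine to curvatures of [D], that is to terms
[H (z _ _) _]; with these, the terms with one [H] cancel by [D H = 0], and the
derivatives of [zeta] cancel by its closedness on [K u], [K v], [K w]. *)
Lemma twisted_jacobi u v w :
  b u (b v w) + b v (b w u) + b w (b u v)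
  = H u (H v w) + H v (H w u) + H w (H u v).
Proof.
have bb t s r : b t (b s r) = H t (b s r) + D (K t) (b s r)
    - D (bF (K s) (K r)) t + z (K t) (bF (K s) (K r)) by rewrite -Kb.
rewrite !bb.
move: (dz (K u) (K v) (K w)) (curvDE (K u) (K v) w) (curvDE (K v) (K w) u)
  (curvDE (K w) (K u) v) (DH (K u) v w) (DH (K v) w u) (DH (K w) u v).
rewrite !(zC (bF _ _)).
move: (HC w (z (K u) (K v))) (HC u (z (K v) (K w))) (HC v (z (K w) (K u))).
move: (HC (D (K u) v) w) (HC (D (K u) w) v) (HC (D (K v) w) u).
move: (HC (D (K v) u) w) (HC (D (K w) v) u) (HC (D (K w) u) v).
separate.
Qed.

End TwistedIdentities.

(** * Operations on sections *)

Section SectionMaps.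
Variables (R : realType) (M : manifold R).

Lemma sections_separated (E : vbundle M) (s t : sections E) :
  (forall phi : {additive sections E -> R}, phi s = phi t) -> s = t.
Proof.
move=> st; apply: sections_eq => x; have [i ix] := vdom_cover E x.
apply: (can_inj (trivK ix)); apply/rowP => a.
have add : {morph (fun r : sections E => triv E i x (r x) 0 a) : r r' / r + r'}.
  by move=> r r' /=; rewrite linearD mxE.
have zero : triv E i x ((0 : sections E) x) 0 a = 0 by rewrite /= linear0 mxE.
exact: (st (HB.pack (fun r : sections E => triv E i x (r x) 0 a)
  (GRing.isNmodMorphism.Build _ _ _ (conj zero add)))).
Qed.

Lemma constf1 : constf M 1 = 1.
Proof. exact: val_inj. Qed.

Lemma hom_app_linear (E F : vbundle M) (K : bundle_hom E F) : linear K.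
Proof. by move=> f s t; apply: sections_eq => x /=; rewrite linearP. Qed.

Lemma bil_app_linearl (E F : vbundle M) (B : bilinear_map F E) t :
  linear (B^~ t).
Proof. by move=> f s s'; apply: sections_eq => x /=; rewrite bil_linearl. Qed.

Lemma bil_app_linearr (E F : vbundle M) (B : bilinear_map F E) s :
  linear (B s).
Proof. by move=> f t t'; apply: sections_eq => x /=; rewrite bil_linearr. Qed.

Lemma linear_morphD (A : pzRingType) (U V : lmodType A) (f : U -> V) :
  linear f -> {morph f : u v / u + v}.
Proof. by move=> lf u v; have := lf 1 u v; rewrite !scale1r. Qed.

Lemma linear_morphZ (A : pzRingType) (U V : lmodType A) (f : U -> V) a u :
  linear f -> f (a *: u) = a *: f u.
Proof.
move=> lf; have f0 : f 0 = 0.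
  by apply: (addrI (f 0)); rewrite -(linear_morphD lf) !addr0.
by have := lf a u 0; rewrite f0 !addr0.
Qed.

Lemma bil_app_biadditive (E F : vbundle M) (B : bilinear_map F E) :
  biadditive B.
Proof.
split=> [t|s]; apply: linear_morphD; first exact: bil_app_linearl.
exact: bil_app_linearr.
Qed.

Lemma bracket_biadditive (E : vbundle M) (LE : lie_algebroid E) :
  biadditive (bracket LE).
Proof.
have add s : {morph bracket LE s : t t' / t + t'}.
  by move=> t t'; have := bracket_linearr LE s 1 t t'; rewrite constf1 !scale1r.
split=> // t s s' /=.
by rewrite bracket_antisym add opprD -!(bracket_antisym LE _ t).
Qed.

Lemma connection_biadditive (E F : vbundle M) (LF : lie_algebroid F) nabla :
  is_connection (E := E) LF nabla -> biadditive nabla.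
Proof.
move=> [hl hr _]; split=> [s X Y|X s t].
  by have := hl 1 X Y s; rewrite !scale1r.
by have := hr X 1 s t; rewrite constf1 !scale1r.
Qed.

Lemma form_antisym (E F : vbundle M) (zeta : two_form F E) X Y :
  zeta X Y = - zeta Y X.
Proof.
apply: alternatingN; first exact: bil_app_biadditive.
by move=> {}X; apply: sections_eq => x; exact: form_alternating.
Qed.

Lemma field_antisym (E : vbundle M) (H : lie_bracket_field E) s t :
  H s t = - H t s.
Proof.
apply: alternatingN; first exact: bil_app_biadditive.
by move=> u; apply: sections_eq => x; exact: field_alternating.
Qed.

Lemma anchor_deriv_hom (E F : vbundle M) (rho : anchor_map E)
    (sigma : anchor_map F) (K : bundle_hom E F) s f :
  (forall x (e : E x),
     anchor_fibre rho x e = anchor_fibre sigma x (hom_fibre K x e)) ->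
  anchor_deriv rho s f = anchor_deriv sigma (K s) f.
Proof.
by move=> h; apply: val_inj; apply/funext => x; rewrite /= h.
Qed.

(** Connections form an affine space over the tensors. *)
Lemma connection_tensorD (E F : vbundle M) (LF : lie_algebroid F) nabla
    (T : sections F -> sections E -> sections E) :
  (forall s, linear (T^~ s)) -> (forall X, linear (T X)) ->
  is_connection LF nabla -> is_connection LF (fun X s => nabla X s + T X s).
Proof.
move=> Tl Tr [hl hr hL]; split=> [f X Y s|X a s t|X f s].
- by rewrite hl Tl scalerDr addrACA.
- by rewrite hr Tr scalerDr addrACA.
- by rewrite hL (linear_morphZ _ _ (Tr X)) scalerDr addrAC.
Qed.

Lemma pullback_linearl (E F : vbundle M) (K : bundle_hom E F)
  (zeta : bilinear_map F E) s : linear (fun X => zeta X (K s)).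
Proof. exact: bil_app_linearl. Qed.

Lemma pullback_linearr (E F : vbundle M) (K : bundle_hom E F)
  (zeta : bilinear_map F E) X : linear (fun s => zeta X (K s)).
Proof. by move=> f s t; rewrite hom_app_linear bil_app_linearr. Qed.

Lemma linear_opp (A : pzRingType) (U V : lmodType A) (f : U -> V) :
  linear f -> linear (fun u => - f u).
Proof. by move=> lf a u v; rewrite lf opprD scalerN. Qed.

End SectionMaps.

(** * The identities for a twisted action algebroid *)

Section TwistedAlgebroid.
Variables (R : realType) (M : manifold R) (E F : vbundle M).
Variables (LE : lie_algebroid E) (LF : lie_algebroid F) (K : bundle_hom E F).
Variables (nabla D : sections F -> sections E -> sections E).
Variables (zeta : two_form F E) (H : sections E -> sections E -> sections E).
(* [H] is a mere operation on sections, so that the lemmas apply before it is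
   known to come from a tensor field. *)
Hypotheses (D_add : biadditive D) (H_add : biadditive H).
Hypothesis H_antisym : forall s t, H s t = - H t s.
Hypothesis nablaE : forall X s, nabla X s = D X s + zeta X (K s).
Hypothesis bracketE : forall s t,
  bracket LE s t = H s t + D (K s) t - D (K t) s + zeta (K s) (K t).
Hypothesis K_bracket : forall s t, K (bracket LE s t) = bracket LF (K s) (K t).
Hypothesis zeta_closed : forall X Y Z, ext_deriv LF D zeta X Y Z = 0.

Let K_add := linear_morphD (hom_app_linear K).
Let zeta_add := bil_app_biadditive zeta.
Let Kb s t :
  K (H s t + D (K s) t - D (K t) s + zeta (K s) (K t)) = bracket LF (K s) (K t).
Proof. by rewrite -bracketE. Qed.

Lemma adjustment_curvatureE X Y s :
  (curvature LF nabla X Y s = - basic_E LE K nabla s (zeta X Y)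
     + zeta (basic_F LF K nabla s X) Y + zeta X (basic_F LF K nabla s Y))
  <-> curvature LF D X Y s = H (zeta X Y) s.
Proof.
rewrite /curvature /basic_E /basic_F !nablaE !bracketE.
have := twisted_curvature (@sections_separated _ _ _) K_add D_add zeta_add
  (bracket_antisym LF) (form_antisym zeta) H_antisym zeta_closed X Y s.
by move=> e; split=> [h|h]; apply/eqP; rewrite -subr_eq0;
  [rewrite -e h subrr|rewrite e h subrr].
Qed.

Hypothesis D_curvature :
  forall X Y s, curvature LF D X Y s = H (zeta X Y) s.

Lemma cartan_identityE s t X :
  (nabla X (bracket LE s t) - bracket LE (nabla X s) t
    - bracket LE s (nabla X t) - nabla (basic_F LF K nabla t X) s
    + nabla (basic_F LF K nabla s X) t = 0)
  <-> D X (H s t) = H (D X s) t + H s (D X t).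
Proof.
rewrite /basic_F !nablaE !bracketE.
rewrite (twisted_cartan (@sections_separated _ _ _) K_add D_add zeta_add H_add
  (bracket_antisym LF) (form_antisym zeta) H_antisym Kb zeta_closed D_curvature).
rewrite -addrA -opprD.
by split=> [/eqP|->]; [rewrite subr_eq0 => /eqP|rewrite subrr].
Qed.

Hypothesis D_parallel : forall X s t, D X (H s t) = H (D X s) t + H s (D X t).

Lemma jacobiE s t u :
  bracket LE s (bracket LE t u) + bracket LE t (bracket LE u s)
    + bracket LE u (bracket LE s t)
  = H s (H t u) + H t (H u s) + H u (H s t).
Proof.
rewrite !bracketE.
exact: (twisted_jacobi (@sections_separated _ _ _) D_add H_add
  (form_antisym zeta) H_antisym Kb zeta_closed D_curvature D_parallel).
Qed.

End TwistedAlgebroid.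

(** * From adjustments to YM connections *)

Section AdjustmentToYM.
Variables (R : realType) (M : manifold R) (E F : vbundle M).
Variables (LE : lie_algebroid E) (LF : lie_algebroid F) (K : bundle_hom E F).
Variables (nabla : sections F -> sections E -> sections E) (zeta : two_form F E).
Hypothesis morphK : lie_algebroid_morphism LE LF K.
Hypothesis adj : strict_adjustment LE LF K nabla zeta.

Let T s t := torsion LE (basic_E LE K nabla) s t + zeta (K s) (K t).
Let D := conn_zeta K nabla zeta.

Let TE s t : T s t =
  bracket LE s t + (nabla (K t) s - nabla (K s) t + zeta (K s) (K t)).
Proof.
apply: sections_separated => phi.
rewrite /T /torsion /basic_E (bracket_antisym LE t).
by rewrite !(raddfD phi, raddfN phi); ring.
Qed.

Let nabla_connection : is_connection LF nabla.
Proof. by case: adj => - []. Qed.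

Let D_connection : is_connection LF D.
Proof.
apply: connection_tensorD nabla_connection => [s|X]; apply: linear_opp.
  exact: pullback_linearl.
exact: pullback_linearr.
Qed.

Let T_antisym s t : T s t = - T t s.
Proof.
rewrite !TE (bracket_antisym LE) (form_antisym zeta (K s)) !opprD !opprK.
by rewrite [- nabla _ _ + nabla _ _]addrC.
Qed.

(* The Leibniz term of the bracket is the derivative of [f] along the anchor of
   [s], that of the connection the derivative along [K s]; they cancel because [K]
   preserves anchors. *)
Let T_linearr s : linear (T s).
Proof.
move=> f t t'.
rewrite !TE (bracket_biadditive LE).2 bracket_leibniz.
rewrite hom_app_linear (connection_linearl nabla_connection).
rewrite (connection_biadditive nabla_connection).2.
rewrite (connection_leibniz nabla_connection) bil_app_linearr.
have -> : anchor_deriv (anchor LE) s f = anchor_deriv (anchor LF) (K s) f.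
  by apply: anchor_deriv_hom => x e; rewrite (morphism_anchor morphK).
apply: sections_separated => phi.
rewrite !scalerDr !scalerN !(raddfD phi, raddfN phi); ring.
Qed.

Let T_linearl t : linear (T^~ t).
Proof.
move=> f s s' /=; rewrite T_antisym T_linearr opprD.
by rewrite -scalerN -!T_antisym.
Qed.

Let bracketE s t : bracket LE s t =
  T s t + D (K s) t - D (K t) s + zeta (K s) (K t).
Proof.
apply: sections_separated => phi.
rewrite TE /D /conn_zeta (form_antisym zeta (K t)).
rewrite !(raddfD phi, raddfN phi); ring.
Qed.

Let nablaE X s : nabla X s = D X s + zeta X (K s).
Proof. by rewrite /D /conn_zeta subrK. Qed.

Let T_biadditive : biadditive T.
Proof. by split=> s; apply: linear_morphD. Qed.

Let D_biadditive := connection_biadditive D_connection.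

Let D_curvature X Y s : curvature LF D X Y s = T (zeta X Y) s.
Proof.
case: adj => cartan curv closed.
apply/(adjustment_curvatureE D_biadditive T_antisym nablaE bracketE closed).
exact: curv.
Qed.

Let D_parallel X s t : D X (T s t) = T (D X s) t + T s (D X t).
Proof.
case: adj => cartan curv closed.
apply/(cartan_identityE D_biadditive T_biadditive T_antisym nablaE bracketE
  (morphism_bracket morphK) closed D_curvature).
exact: cartan_identity cartan s t X.
Qed.

Let T_jacobi s t u : T s (T t u) + T t (T u s) + T u (T s t) = 0.
Proof.
case: adj => cartan curv closed.
rewrite -(jacobiE D_biadditive T_biadditive T_antisym bracketE
  (morphism_bracket morphK) closed D_curvature D_parallel).
exact: bracket_jacobi.
Qed.

Lemma adjustment_to_YM : exists H : lie_bracket_field E,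
     [/\ forall s t : sections E, H s t = T s t,
         strict_YM_connection LF H D zeta
       & is_twisted_action_algebroid LF LE K H D zeta].
Proof.
have [B BE] := bilinear_tensor T_linearl T_linearr.
have altB x (u : E x) : bil_fibre B u u = 0.
  have [s <-] := section_through u.
  have : (T s s) x = (- T s s) x by rewrite {1}T_antisym.
  rewrite -BE /= scaleN1r => /eqP; rewrite -subr_eq0 opprK -mulr2n -scaler_nat.
  by rewrite scaler_eq0 pnatr_eq0 => /eqP.
have jacB x (u v w : E x) : bil_fibre B u (bil_fibre B v w)
    + bil_fibre B v (bil_fibre B w u) + bil_fibre B w (bil_fibre B u v) = 0.
  have [[s <-] [t <-]] := (section_through u, section_through v).
  have [r <-] := section_through w.
  by have := congr1 (fun q : sections E => q x) (T_jacobi s t r); rewrite -!BE.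
exists (LieBracketField altB jacB); split=> //; split=> //.
- by move=> X s t; rewrite /= !BE.
- by move=> X Y s; rewrite /= BE.
- by case: adj.
- by move=> x e; rewrite (morphism_anchor morphK).
- by move=> s t; rewrite bracketE /twisted_bracket /= BE.
Qed.

End AdjustmentToYM.

(** * From YM connections to adjustments *)

Section YMToAdjustment.
Variables (R : realType) (M : manifold R) (E F : vbundle M).
Variables (LF : lie_algebroid F) (H : lie_bracket_field E).
Variables (D : sections F -> sections E -> sections E) (zeta : two_form F E).
Hypothesis YM : strict_YM_connection LF H D zeta.
Variable K : bundle_hom E F.
Hypothesis K_twisted : forall s t : sections E,
  bracket LF (K s) (K t) = K (twisted_bracket K H D zeta s t).

Let D_connection := YM_connection YM.
Let D_add := connection_biadditive D_connection.
Let H_add := bil_app_biadditive H.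
Let b := twisted_bracket K H D zeta.

Lemma comp_anchor_smooth i v f : smooth_on (vdom E i)
  (fun x => anchor_fibre (anchor LF) x (hom_fibre K x (frame E i x v)) f).
Proof.
apply: smooth_on_local => x ix; have [j jx] := vdom_cover F x.
have oV : open (vdom E i `&` vdom F j)%classic by apply: openI; exact: vdom_open.
exists (vdom E i `&` vdom F j)%classic; split=> //.
pose c a y := triv F j y (hom_fibre K y (frame E i y v)) 0 a.
have : smooth_on (vdom E i `&` vdom F j)%classic (fun y => \sum_a (c a *
    (fun y => anchor_fibre (anchor LF) y (frame F j y (delta_mx 0 a)) f)) y).
  apply: smooth_on_sum => // a; apply: smooth_onM => //; first exact: hom_smooth.
  by apply: smooth_on_sub (anchor_smooth (anchor LF) j _ f) => y [].
apply: smooth_on_eq => // y [iy jy].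
rewrite [in RHS](section_frame (fun y => hom_fibre K y (frame E i y v)) jy).
rewrite linear_sum -[RHS]/((val (\sum_a _)) f) raddf_sum fct_sumE.
by apply: eq_bigr => a _; rewrite linearZ.
Qed.

Definition comp_anchor : anchor_map E :=
  @AnchorMap _ _ _ (fun x => anchor_fibre (anchor LF) x \o hom_fibre K x)
    comp_anchor_smooth.

Lemma twisted_linearr s (a : R) t u :
  b s (constf M a *: t + u) = constf M a *: b s t + b s u.
Proof.
rewrite /b /twisted_bracket (connection_linearr D_connection) hom_app_linear.
rewrite (connection_linearl D_connection) !bil_app_linearr.
apply: sections_separated => phi.
rewrite !scalerDr !scalerN !(raddfD phi, raddfN phi); ring.
Qed.

Lemma twisted_antisym s t : b s t = - b t s.
Proof.
rewrite /b /twisted_bracket (field_antisym H s) (form_antisym zeta (K s)).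
by apply: sections_separated => phi; rewrite !(raddfD phi, raddfN phi); ring.
Qed.

Lemma twisted_leibniz s (f : smoothfun M) t :
  b s (f *: t) = f *: b s t + anchor_deriv comp_anchor s f *: t.
Proof.
have -> : anchor_deriv comp_anchor s f = anchor_deriv (anchor LF) (K s) f.
  exact: anchor_deriv_hom.
rewrite /b /twisted_bracket (connection_leibniz D_connection).
rewrite (linear_morphZ _ _ (hom_app_linear K)).
rewrite (linear_morphZ _ _ (bil_app_linearr H s)).
rewrite (linear_morphZ _ _ (bil_app_linearr zeta (K s))).
rewrite -[f *: K t]addr0 (connection_linearl D_connection).
rewrite (_ : D 0 s = 0) ?addr0; last first.
  by apply: (addrI (D 0 s)); rewrite -D_add.1 !addr0.
apply: sections_separated => phi.
rewrite !scalerDr !scalerN !(raddfD phi, raddfN phi); ring.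
Qed.

Lemma twisted_bracket_jacobi s t u :
  b s (b t u) + b t (b u s) + b u (b s t) = 0.
Proof.
rewrite /b /twisted_bracket (twisted_jacobi (@sections_separated _ _ _) D_add
  H_add (form_antisym zeta) (field_antisym H) _ (YM_strict YM) (YM_curvature YM)
  (YM_parallel YM)) => [|v w]; last by rewrite K_twisted.
by apply: sections_eq => x /=; exact: field_jacobi.
Qed.

Definition twisted_algebroid : lie_algebroid E :=
  LieAlgebroid twisted_linearr twisted_antisym twisted_bracket_jacobi
    twisted_leibniz.

Lemma twisted_algebroidP :
  is_twisted_action_algebroid LF twisted_algebroid K H D zeta.
Proof. by []. Qed.

Variable LE : lie_algebroid E.
Hypothesis LE_twisted : is_twisted_action_algebroid LF LE K H D zeta.
Let nabla X s := D X s + zeta X (K s).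

Lemma twisted_morphism : lie_algebroid_morphism LE LF K.
Proof.
split=> [x e|s t]; first by rewrite (twisted_anchor LE_twisted).
by rewrite (twisted_bracketE LE_twisted) K_twisted.
Qed.

Let nablaE X s : nabla X s = D X s + zeta X (K s).
Proof. by []. Qed.

Lemma YM_to_adjustment : strict_adjustment LE LF K nabla zeta.
Proof.
have KE := morphism_bracket twisted_morphism.
have brE := twisted_bracketE LE_twisted.
have closed := YM_strict YM.
split=> [|X Y s|X Y Z].
- split.
    apply: connection_tensorD D_connection => [s|X].
      exact: pullback_linearl.
    exact: pullback_linearr.
  move=> s t X; apply/(cartan_identityE D_add H_add (field_antisym H) nablaE
    brE KE closed (YM_curvature YM)).
  exact: (YM_parallel YM).
- apply/(adjustment_curvatureE D_add (field_antisym H) nablaE brE closed).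
  exact: (YM_curvature YM).
- rewrite (_ : conn_zeta K nabla zeta = D) ?closed//.
  by apply/funext => X'; apply/funext => s; rewrite /conn_zeta addrK.
Qed.

Lemma twisted_torsion s t :
  H s t = torsion LE (basic_E LE K nabla) s t + zeta (K s) (K t).
Proof.
rewrite /torsion /basic_E (bracket_antisym LE t) (twisted_bracketE LE_twisted).
rewrite /twisted_bracket /nabla (form_antisym zeta (K t)).
by apply: sections_separated => phi; rewrite !(raddfD phi, raddfN phi); ring.
Qed.

End YMToAdjustment.

(** * The correspondence *)

Theorem theorem2p6 (R : realType) (M : manifold R) (F : vbundle M)
    (LF : lie_algebroid F) :
  (forall (E : vbundle M) (LE : lie_algebroid E) (K : bundle_hom E F),
     lie_algebroid_morphism LE LF K ->
   forall (nabla : sections F -> sections E -> sections E)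
     (zeta : two_form F E),
     strict_adjustment LE LF K nabla zeta ->
   exists H : lie_bracket_field E,
     [/\ forall mu nu : sections E,
           H mu nu = torsion LE (basic_E LE K nabla) mu nu
                     + zeta (K mu) (K nu),
         strict_YM_connection LF H (conn_zeta K nabla zeta) zeta
       & is_twisted_action_algebroid LF LE K H
           (conn_zeta K nabla zeta) zeta])
  /\
  (forall (E : vbundle M) (H : lie_bracket_field E)
     (nablaz : sections F -> sections E -> sections E) (zeta : two_form F E),
     strict_YM_connection LF H nablaz zeta ->
   forall K : bundle_hom E F,
     (forall mu nu : sections E,
        bracket LF (K mu) (K nu) = K (twisted_bracket K H nablaz zeta mu nu)) ->
   let nabla := fun (X : sections F) (mu : sections E) =>
     nablaz X mu + zeta X (K mu) in
   (exists LE : lie_algebroid E,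
      is_twisted_action_algebroid LF LE K H nablaz zeta) /\
   (forall LE : lie_algebroid E,
      is_twisted_action_algebroid LF LE K H nablaz zeta ->
      [/\ lie_algebroid_morphism LE LF K,
          strict_adjustment LE LF K nabla zeta
        & forall mu nu : sections E,
            H mu nu = torsion LE (basic_E LE K nabla) mu nu
                      + zeta (K mu) (K nu)])).
Proof.
split=> [E LE K morphK nabla zeta adj|E H D zeta YM K K_twisted nabla].
  exact: adjustment_to_YM morphK adj.
split.
  exists (twisted_algebroid YM K_twisted); exact: twisted_algebroidP.
move=> LE LE_twisted; split.
- exact: twisted_morphism LE_twisted.
- exact: YM_to_adjustment LE_twisted.
- exact: twisted_torsion LE_twisted.
Qed.
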